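(* Let $A: L^2(0,1)\to\ell^2$ be given by $[Ax]_j=\int_0^1 t^{j-1}x(t)\,dt$, $j=1,2,\dots$, and for a function $x$ put $\delta=\|Ax\|_{\ell^2}$. (i) Assume that $x\in H^1(0,1)$ with the a priori bound $\|x'\|_{L^2(0,1)}\le E_1$. Then, with a constant $C>0$, $$|x(1)|\le C\,(E_1\delta)^{1/2},$$ and consequently the corresponding asymptotics $$\sup_{x\in H^1(0,1):\ \|x'\|_{L^2(0,1)}\le E_1,\ \|Ax\|_{\ell^2}\le\delta}|x(1)|=\mathcal{O}(\sqrt{\delta})\quad\text{as }\delta\to0$$ holds. (ii) Furthermore, for $x\in H^1(0,1)$ with the a priori bound $\|x'\|_{L^\infty(0,1)}\le E_\infty$, the stability estimate $$|x(1)|\le\tilde C\,\delta^{2/3}\ln(1/\delta)$$ holds with a constant $\tilde C>0$ depending on $E_\infty$ whenever $\delta>0$ is sufficiently small. This yields the asymptotics $$\sup_{x\in H^1(0,1):\ \|x'\|_{L^\infty(0,1)}\le E_\infty,\ \|Ax\|_{\ell^2}\le\delta}|x(1)|=\mathcal{O}\left(\delta^{2/3}\ln(1/\delta)\right)\quad\text{as }\delta\to0.$$ (iii) If, however, in the situation of (ii) one has $\delta\ge\underline c>0$, then there is an estimate of the form $$|x(1)|\le\bar C\,\delta$$ with some constant $\bar C>0$ depending on $E_\infty$ and $\underline c$.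
   Context: $A$ is a bounded injective linear operator from the real Hilbert space $L^2(0,1)$ to the real Hilbert space $\ell^2$ of square summable sequences indexed by $j=1,2,\dots$. $H^1(0,1)$ is the Sobolev space of functions in $L^2(0,1)$ with weak derivative $x'\in L^2(0,1)$; for $x\in H^1(0,1)$ the point value $x(1)$ is well defined (via the continuous representative, i.e. by the trace theorem). In the suprema, $\delta>0$ denotes a free parameter bounding $\|Ax\|_{\ell^2}$.
   Formalization: The first estimate of (i) is proved for δ ≤ K·E_1, for any K>0, with C depending only on K; without such a bound it is false: a constant function x=c has x'=0, |x(1)|=c and δ=cπ/√6, so it fails for E_1=0 or for c large. *)

(* Defs.v *)
From HB Require Import structures.
From mathcomp Require Import all_boot all_order all_algebra.
From mathcomp Require Import all_classical all_reals all_analysis.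

Set Implicit Arguments.
Unset Strict Implicit.
Unset Printing Implicit Defensive.

Import Order.TTheory GRing.Theory Num.Theory.
Import numFieldNormedType.Exports.

Local Open Scope classical_set_scope.
Local Open Scope ring_scope.

(* Functions on (0,1) are represented by measurable functions R -> R; their
   values outside (0,1) never matter, since all norms use [mu01] and all
   integrals are over (0,1). *)
Section SobolevSpace.
Context {R : realType}.
Implicit Types (x y phi : R -> R) (v : R).

Local Notation mu := (@lebesgue_measure R).

Definition mu01 : {measure set (measurableTypeR R) -> \bar R} :=
  mrestr mu (measurable_itv `]0%R, 1%R[).

Definition normL (p : \bar R) x : \bar R := 'N[mu01]_p[EFin \o x]%E.

Definition L2 x : Prop := x \in Lfun mu01 2%:E.

(* The space C_c^infty(0,1), extended by zero to the real line. *)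
Definition test_function phi : Prop :=
  (forall (n : nat) (t : R), derivable (derive1n n phi) t 1) /\
  exists a b : R, [/\ 0 < a, b < 1 &
    forall t, t \notin `[a, b]%R -> phi t = 0].

Definition weak_derivative x y : Prop :=
  forall phi, test_function phi ->
    \int[mu]_(t in `]0, 1[) (x t * derive1 phi t) =
    - \int[mu]_(t in `]0, 1[) (y t * phi t).

(* x is in H^1(0,1), and y is (a representative of) its weak derivative x'. *)
Definition H1 x y : Prop := [/\ L2 x, L2 y & weak_derivative x y].

(* The point value x(1) is v: it is read off the continuous representative
   of x on the closed interval. *)
Definition value1 x v : Prop :=
  exists u : R -> R, [/\ {within `[0, 1]%classic, continuous u},
    u = x %[ae mu in `]0, 1[%classic] & u 1 = v].

End SobolevSpace.

Section MomentOperator.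
Context {R : realType}.
Implicit Types (x y : R -> R) (a : nat -> R).

(* The moment operator A, with entries indexed from 0: [moments x j] is
   [Ax]_(j+1). *)
Definition moments x : nat -> R :=
  fun j => \int[lebesgue_measure]_(t in `]0, 1[) (t ^+ j * x t).

Definition norm_l2 a : \bar R := 'N[counting]_2%:E[EFin \o a]%E.

(* The supremum of |x(1)| over all x in H^1(0,1) with ||x'||_{L^p} <= E and
   ||Ax|| <= d. *)
Definition sup_value1 (p : \bar R) (E d : R) : \bar R :=
  ereal_sup [set r : \bar R | exists x x' v,
    [/\ H1 x x', (normL p x' <= E%:E)%E, (norm_l2 (moments x) <= d%:E)%E,
        value1 x v & r = `|v|%:E]].

(* S = O(g) as d -> 0 with d > 0, for S with extended real values (hence
   finite for all small d). *)
Definition ebigO_0 (S : R -> \bar R) (g : R -> R) : Prop :=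
  let F := (0 : R)^'+ in
  (\forall d \near F, S d \is a fin_num) /\ (fine \o S) =O_F g.

End MomentOperator.

(* Main.v *)
(** Testing the weak derivative against t^(j+1), suitably cut off near 0 and 1,
    gives (j+1) [Ax]_(j+1) = x(1) - int_0^1 t^(j+1) x'(t) dt, so that
    |x(1)| <= (j+1) |[Ax]_(j+1)| + |int_0^1 t^(j+1) x'(t) dt|.
    Among the n indices j in [n, 2n) one entry of Ax is at most delta / sqrt n,
    and the integral is at most E_1 / sqrt n (Cauchy-Schwarz), respectively
    E_oo / n. Hence |x(1)| <= 2 sqrt n delta + E_1 / sqrt n, resp. E_oo / n for
    the last term, and the estimates follow with n of the order of E_1 / delta,
    resp. delta^(-2/3). The second choice even avoids the logarithm. *)

Require Import Defs.
From mathcomp Require Import all_boot all_order all_algebra.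
From mathcomp Require Import all_classical all_reals all_analysis.
From mathcomp Require Import measurable_realfun ess_sup_inf.
From mathcomp Require Import zify ring lra.
Set Implicit Arguments.
Unset Strict Implicit.
Unset Printing Implicit Defensive.
Import Order.TTheory GRing.Theory Num.Theory.
Import numFieldNormedType.Exports.
Local Open Scope classical_set_scope.
Local Open Scope ring_scope.

(** The obstacle is that [test_function] only admits smooth functions supported in a compact part of
    (0,1), while t^(j+1) equals 1 at the right endpoint. The value x(1) therefore has to come out of
    a limit of cutoffs, and the derivatives of these concentrate at both endpoints, where dominated
    convergence fails. Two facts replace it: these derivatives are bounded in L^1, and they are
    tested against a continuous function vanishing at 0 and 1. Vanishing at 1 is achieved by
    subtracting the constant u(1) from the continuous representative u. This does not change the
    integral against the derivative of the test function, which has integral 0. An explicit cutoff,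
    exp(-1/s) composed with a quadratic polynomial, turns every estimate on its derivative into an
    identity between such exponentials. *)

(** * Flat exponentials P(1/s) exp(-1/s) and their smoothness *)

Section FlatExponential.
Context {R : realType}.
Implicit Types (p q P : {poly R}) (s t : R) (f g : R -> R).

(* The functions P(1/s) exp(-1/s), extended by 0 to s <= 0: letting P range over
   all polynomials makes the family closed under differentiation. *)
Definition flatexp P s : R := if 0 < s then P.[s^-1] * expR (- s^-1) else 0.

Lemma flatexp_gt0E P s : 0 < s -> flatexp P s = P.[s^-1] * expR (- s^-1).
Proof. by rewrite /flatexp => ->. Qed.

Lemma flatexp_le0 P s : s <= 0 -> flatexp P s = 0.
Proof. by rewrite /flatexp leNgt => /negbTE ->. Qed.

(** A single term y^k / k! of the exponential series is at most exp y. *)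
Lemma exprn_expRN_le (k : nat) (y : R) : 0 <= y ->
  y ^+ k * expR (- y) <= k`!%:R.
Proof.
move=> y0; rewrite expRN ler_pdivrMr ?expR_gt0//.
case: k => [|k]; first by rewrite expr0 fact0 mul1r -expR0 ler_expR.
have := expR_ge1Dxn k y0; set f := (_ `!%:R : R) => h.
have f0 : 0 < f by rewrite ltr0n fact_gt0.
rewrite mulrC -ler_pdivrMr// (le_trans _ h)// lerDr//.
Qed.

Lemma flatexp_bounded P : exists2 C : R, 0 <= C & forall s, `|flatexp P s| <= C.
Proof.
exists (\sum_(i < size P) `|P`_i| * i`!%:R).
  by apply: sumr_ge0 => i _; rewrite mulr_ge0.
move=> s; have [s0|s0] := leP s 0.
  by rewrite flatexp_le0// normr0; apply: sumr_ge0 => i _; rewrite mulr_ge0.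
rewrite flatexp_gt0E// horner_coef big_distrl/=.
apply: (le_trans (ler_norm_sum _ _ _)); apply: ler_sum => i _.
rewrite -mulrA normrM ler_wpM2l//.
have sV0 : 0 <= s^-1 by rewrite invr_ge0 ltW.
by rewrite ger0_norm ?exprn_expRN_le// mulr_ge0 ?expR_ge0 ?exprn_ge0.
Qed.

(** Each factor ['X] pays for one factor s. Together with [flatexp_bounded] this gives decay of
    every order at 0. *)
Lemma flatexpMX P s : flatexp P s = s * flatexp (P * 'X) s.
Proof.
have [s0|s0] := leP s 0; first by rewrite !flatexp_le0// mulr0.
by rewrite !flatexp_gt0E// hornerMX; field; rewrite gt_eqF.
Qed.

(** With y = 1/s and dy/ds = - y^2, the chain rule gives (P(y) - P'(y)) y^2 exp(-y) for s > 0; the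
    y^2 is the factor ['X * 'X]. *)
Lemma is_derive_flatexp P s :
  is_derive s (1 : R) (flatexp P) (flatexp ((P - P^`()) * 'X * 'X) s).
Proof.
have [s0|s0|->] := ltgtP s 0.
- rewrite flatexp_le0 ?ltW//.
  apply: (@near_eq_is_derive _ _ _ (cst 0)).
  near=> r; rewrite flatexp_le0 ?ltW//; near: r.
  exact: lt_nbhsl.
- apply: (@near_eq_is_derive _ _ _ (fun s => P.[s^-1] * expR (- s^-1))).
    by near=> r; rewrite flatexp_gt0E//; near: r; exact: lt_nbhsr.
  have sN0 : s != 0 by rewrite gt_eqF.
  have dV : is_derive s (1 : R) (fun r : R => r^-1) (- s ^- 2).
    have := @is_deriveV R id s 1 1 sN0 (is_derive_id _ _).
    by rewrite /GRing.scale /= mulr1.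
  have d1 := is_derive1_comp (is_derive_poly P s^-1) dV.
  have d2 := @is_derive1_comp R expR (fun r => - r^-1) s _ _
    (is_derive_expR _) (is_deriveN dV).
  rewrite flatexp_gt0E//; apply: (is_derive_eq (is_deriveM d1 d2)).
  rewrite /GRing.scale /= !hornerMX !hornerE/= opprK.
  by field.
- rewrite flatexp_le0//.
  suff h : (h^-1 *: ((flatexp P \o shift 0) (h *: (1 : R)) - flatexp P 0))
      @[h --> 0^'] --> (0 : R).
    by split; [apply/cvg_ex; exists 0 | exact/cvg_lim].
  have [C C0 hC] := flatexp_bounded (P * 'X * 'X).
  apply/cvgr0Pnorm_le => e e0.
  near=> h.
  have hN0 : h != 0 by near: h; exact: nbhs_dnbhs_neq.
  rewrite /shift/= /GRing.scale/= mulr1 addr0 (@flatexp_le0 P 0)// subr0.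
  (* One factor h cancels the denominator of the difference quotient, and a second one makes the
     quotient O(h). *)
  rewrite flatexpMX mulKf// flatexpMX normrM.
  apply: (@le_trans _ _ (`|h| * (C + 1))).
    by rewrite ler_wpM2l// (le_trans (hC _))// lerDl.
  rewrite -ler_pdivlMr ?ltr_wpDl//.
  near: h; apply: dnbhs0_le; rewrite divr_gt0 ?ltr_wpDl//.
Unshelve. all: by end_near. Qed.

(** The product rule splits each term into two of the same shape, so sums are what makes the family
    stable under [derive1]. Smoothness then follows by induction on the order of the derivative. *)
Inductive flatexp_sum q : (R -> R) -> Prop :=
| flatexp_sum1 p P : flatexp_sum q (fun t => p.[t] * flatexp P q.[t])
| flatexp_sumD f g : flatexp_sum q f -> flatexp_sum q g -> flatexp_sum q (f + g).

Lemma is_derive_hornerM_flatexp q p P t :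
  is_derive t (1 : R) (fun t => p.[t] * flatexp P q.[t])
    (p^`().[t] * flatexp P q.[t] +
     p.[t] * (q^`().[t] * flatexp ((P - P^`()) * 'X * 'X) q.[t])).
Proof.
have d := is_derive1_comp (is_derive_flatexp P q.[t]) (is_derive_poly q t).
apply: (is_derive_eq (is_deriveM (is_derive_poly p t) d)).
by rewrite /GRing.scale/=; ring.
Qed.

Lemma flatexp_sum_derive q f : flatexp_sum q f ->
  flatexp_sum q (derive1 f) /\ forall t, derivable f t 1.
Proof.
elim=> {f} [p P|f g _ [sf df] _ [sg dg]].
- split; last by move=> t; case: (is_derive_hornerM_flatexp q p P t).
  rewrite (_ : derive1 _ = (fun t => p^`().[t] * flatexp P q.[t]) +
     (fun t => (p * q^`()).[t] * flatexp ((P - P^`()) * 'X * 'X) q.[t])).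
    by apply: flatexp_sumD; exact: flatexp_sum1.
  apply/funext => t; rewrite derive1E.
  have [_ ->] := is_derive_hornerM_flatexp q p P t.
  by rewrite !fctE hornerM !mulrA.
- split; last by move=> t; exact: derivableD.
  rewrite (_ : derive1 _ = derive1 f + derive1 g); first exact: flatexp_sumD.
  by apply/funext => t; rewrite derive1E deriveD// fctE !derive1E.
Qed.

Lemma flatexp_sum_smooth q f (n : nat) t : flatexp_sum q f ->
  derivable (derive1n n f) t 1.
Proof.
move=> qf; suff /flatexp_sum_derive[_] : flatexp_sum q (derive1n n f) by apply.
by elim: n => // n /flatexp_sum_derive[].
Qed.

End FlatExponential.

(** * Integration over the open unit interval *)

Section UnitInterval.
Context {R : realType}.
Implicit Types (f g h y : R -> R) (C t : R).
Local Notation mu := (@lebesgue_measure R).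
Local Notation I01 := (`]0, 1[%classic : set R).

Lemma mu_I01 : mu I01 = 1%E.
Proof. by rewrite lebesgue_measure_itv/= lte_fin ltr01 sube0. Qed.

Lemma Rintegral01_cst (r : R) : \int[mu]_(t in I01) r = r.
Proof. by rewrite Rintegral_cst// [X in fine X]mu_I01 mulr1. Qed.

Lemma bounded01P f C : (forall t, I01 t -> `|f t| <= C) -> [bounded f t | t in I01].
Proof.
move=> fC; rewrite /bounded_near; near=> M => t It /=.
apply: (le_trans (fC _ It)).
by near: M; apply: nbhs_pinfty_ge; rewrite num_real.
Unshelve. all: by end_near. Qed.

Lemma integrable01_bounded f C : measurable_fun I01 f ->
  (forall t, I01 t -> `|f t| <= C) -> mu.-integrable I01 (EFin \o f).
Proof.
move=> mf fC; apply: measurable_bounded_integrable => //.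
  by rewrite [ltLHS]mu_I01 ltry.
exact: bounded01P fC.
Qed.

Lemma integrable01M_bounded y h C : mu.-integrable I01 (EFin \o y) ->
  measurable_fun I01 h -> (forall t, I01 t -> `|h t| <= C) ->
  mu.-integrable I01 (EFin \o (fun t => y t * h t)).
Proof.
move=> iy mh hC.
have := @integrableMl _ _ _ mu I01 _ (EFin \o y) h iy mh.
by apply => //; exact: bounded01P hC.
Qed.

Lemma Rintegral01_dominated (f_ : nat -> R -> R) f g :
  (forall n, measurable_fun I01 (f_ n)) ->
  (forall t, I01 t -> f_ ^~ t @ \oo --> f t) ->
  mu.-integrable I01 (EFin \o g) ->
  (forall n t, I01 t -> `|f_ n t| <= g t) ->
  (\int[mu]_(t in I01) f_ n t) @[n --> \oo] --> \int[mu]_(t in I01) f t.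
Proof.
move=> mf ff ig fg.
have mI : measurable I01 by exact: measurable_itv.
have [] := @dominated_convergence _ _ _ mu I01 mI (fun n => EFin \o f_ n)
    (EFin \o f) (EFin \o g).
- by move=> n; apply/measurable_EFinP; exact: mf.
- apply/measurable_EFinP; apply: (measurable_fun_cvg mf) => t It; exact: ff.
- by apply: nearW => t It; apply: cvg_EFin; [exact: nearW | exact: ff].
- exact: ig.
- by apply: nearW => t n It; rewrite /= lee_fin fg.
move=> ifn _ h; apply: fine_cvg; rewrite fineK//.
exact: integrable_fin_num ifn.
Qed.

Lemma measurable01_continuous h : continuous h -> measurable_fun I01 h.
Proof. by move=> ch; apply: measurable_funTS; exact: continuous_measurable_fun. Qed.

Lemma within01_bounded (u : R -> R) : {within `[0, 1]%classic, continuous u} ->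
  exists2 C : R, 0 <= C & forall t, t \in `[0, 1] -> `|u t| <= C.
Proof.
move=> cu; have cn : {within `[0, 1]%classic, continuous (fun t : R => `|u t| : R)}.
  by move=> t; apply: continuous_comp; [exact: cu | exact: norm_continuous].
have [c c01 uc] := EVT_max ler01 cn.
by exists `|u c|.
Qed.

Lemma within01_measurable (u : R -> R) : {within `[0, 1]%classic, continuous u} ->
  measurable_fun I01 u.
Proof.
move=> cu.
have mu01 : measurable_fun (`[0, 1]%classic : set R) u.
  exact: subspace_continuous_measurable_fun.
apply: (measurable_funS _ _ mu01) => //.
by move=> t /=; rewrite !in_itv/= => /andP[/ltW-> /ltW->].
Qed.

Lemma I01_cc t : I01 t -> t \in `[0, 1].
Proof. by rewrite /= !in_itv/= => /andP[/ltW-> /ltW->]. Qed.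

Lemma continuous01_bounded h : continuous h ->
  exists2 C, 0 <= C & forall t, I01 t -> `|h t| <= C.
Proof.
move=> ch; have [|C C0 hC] := @within01_bounded h; first exact: continuous_subspaceT.
by exists C => // t /I01_cc; exact: hC.
Qed.

Lemma continuous01_integrable h : continuous h -> mu.-integrable I01 (EFin \o h).
Proof.
move=> ch; have [C _ hC] := continuous01_bounded ch.
exact: integrable01_bounded (measurable01_continuous ch) hC.
Qed.

Lemma is_derive_continuous f f' : (forall t, is_derive t (1 : R) f (f' t)) ->
  continuous f.
Proof.
by move=> df t; apply/differentiable_continuous/derivable1_diffP; case: (df t).
Qed.

Lemma Rintegral01_derive f f' : (forall t, is_derive t (1 : R) f (f' t)) ->
  continuous f' -> \int[mu]_(t in I01) f' t = f 1 - f 0.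
Proof.
move=> df cf'.
have cf := is_derive_continuous df.
rewrite /Rintegral -(@integral_itv_bndoo _ _ _ _ true false); last first.
  by apply/measurable_EFinP; exact: measurable01_continuous.
rewrite (@continuous_FTC2 _ f' f)//; first exact: continuous_subspaceT.
- split; first by move=> t _; case: (df t).
  + by apply: cvg_at_right_filter; exact: cf.
  + by apply: cvg_at_left_filter; exact: cf.
- by move=> t _; rewrite derive1E; case: (df t).
Qed.

Lemma Rintegral01_exprn (k : nat) : \int[mu]_(t in I01) t ^+ k = k.+1%:R^-1.
Proof.
have d (t : R) : is_derive t (1 : R) (horner (k.+1%:R^-1 *: 'X^(k.+1))) (t ^+ k).
  apply: (is_derive_eq (is_derive_poly _ _)).
  by rewrite derivZ derivXn hornerZ hornerMn hornerXn mulrnAr -mulrnAl -mulr_natl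
    divff ?mul1r// pnatr_eq0.
rewrite (Rintegral01_derive d); last exact: exprn_continuous.
by rewrite !hornerE expr1n expr0n/= mulr1 mulr0 subr0.
Qed.

End UnitInterval.

(** * Smooth cutoffs and the concentration of their derivatives at the endpoints *)

Section Cutoff.
Context {R : realType}.
Implicit Types (f g : R -> R) (n : nat) (t : R) (P p : {poly R}).
Local Notation mu := (@lebesgue_measure R).
Local Notation I01 := (`]0, 1[%classic : set R).

(** Since 1/u tends to 0, both factors converge. The limit is 1 for P = 1 (the cutoff) and 0 for P =
    ['X^k] with k > 0 (its weighted derivative). *)
Lemma cvg_flatexp_pinfty P (u : nat -> R) :
  u n @[n --> \oo] --> +oo -> flatexp P (u n) @[n --> \oo] --> P.[0].
Proof.
move=> uy.
have uV : (u n)^-1 @[n --> \oo] --> (0 : R).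
  apply/cvgr0Pnorm_le => e e0; near=> n.
  have un : e^-1 <= u n by near: n; move/cvgryPge : uy; apply.
  have un0 : 0 < u n by rewrite (lt_le_trans _ un)// invr_gt0.
  by rewrite ger0_norm ?invr_ge0 ?(ltW un0)// invf_ple ?posrE.
have : P.[(u n)^-1] * expR (- (u n)^-1) @[n --> \oo] --> P.[0] * expR (- 0).
  apply: cvgM.
    exact: (@continuous_cvg _ R R _ _ (fun n => (u n)^-1) (horner P) 0
      (@continuous_horner _ P 0) uV).
  apply: (@continuous_cvg _ R R _ _ (fun n => - (u n)^-1) expR);
    [exact: continuous_expR | exact: cvgN].
rewrite oppr0 expR0 mulr1.
apply: cvg_trans; apply: near_eq_cvg; near=> n.
rewrite flatexp_gt0E//; near: n.
by move/cvgryPgt : uy; apply.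
Unshelve. all: by end_near. Qed.

Lemma flatexpXn_le k s : `|flatexp 'X^k s| <= k`!%:R :> R.
Proof.
have [s0|s0] := leP s 0; first by rewrite flatexp_le0// normr0.
have sV0 : 0 <= s^-1 by rewrite invr_ge0 ltW.
rewrite flatexp_gt0E// hornerXn ger0_norm ?exprn_expRN_le//.
by rewrite mulr_ge0 ?expR_ge0 ?exprn_ge0.
Qed.

Lemma flatexpXn_ge0 k s : 0 <= flatexp 'X^k s :> R.
Proof.
have [s0|s0] := leP s 0; first by rewrite flatexp_le0.
by rewrite flatexp_gt0E// hornerXn mulr_ge0 ?expR_ge0 ?exprn_ge0 ?invr_ge0 ?ltW.
Qed.

(* The argument of the cutoff: it is positive exactly where t(1 - t) > 1/(n+1),
   so that exp(-1/hump) is supported in [1/(n+1), 1 - 1/(n+1)] and tends to 1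
   on (0,1). *)
Definition hump n : {poly R} := n.+1%:R *: ('X * (1 - 'X)) - 1.

Lemma hump_horner n t : (hump n).[t] = n.+1%:R * (t * (1 - t)) - 1.
Proof. by rewrite /hump !hornerE. Qed.

Lemma deriv_hump_horner n t : (hump n)^`().[t] = n.+1%:R * (1 - 2 * t).
Proof.
by rewrite /hump !poly.derivE !hornerE; ring.
Qed.

Definition cutoff n t := flatexp 1 (hump n).[t].
(** The nonnegative factor of the derivative of [cutoff n]: [flatexp 1] has derivative
    [flatexp 'X^2], and [hump n] has derivative n.+1 * (1 - 2t), whose sign-changing part is split
    off. *)
Definition peak n t := n.+1%:R * flatexp 'X^2 (hump n).[t].

Lemma is_derive_cutoffM p n t :
  is_derive t (1 : R) (fun t => p.[t] * cutoff n t)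
    (p^`().[t] * cutoff n t + p.[t] * ((1 - 2 * t) * peak n t)).
Proof.
apply: (is_derive_eq (is_derive_hornerM_flatexp (hump n) p 1 t)).
rewrite deriv_hump_horner derivC subr0 mul1r -expr2 /cutoff /peak; ring.
Qed.

Lemma continuous_cutoffM p n : continuous (fun t => p.[t] * cutoff n t).
Proof. exact: (is_derive_continuous (is_derive_cutoffM p n)). Qed.

Lemma continuous_cutoff n : continuous (cutoff n).
Proof.
rewrite (_ : cutoff n = (fun t => (1 : {poly R}).[t] * cutoff n t)).
  exact: continuous_cutoffM.
by apply/funext => t; rewrite !hornerE.
Qed.

Lemma continuous_peak n : continuous (peak n).
Proof.
rewrite (_ : peak n = (fun t => n.+1%:R%:P.[t] * flatexp 'X^2 (hump n).[t])).
  exact: (is_derive_continuous (is_derive_hornerM_flatexp _ _ _)).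
by apply/funext => t; rewrite hornerC.
Qed.

Lemma cutoff_smooth p n k t : derivable (derive1n k (fun t => p.[t] * cutoff n t)) t 1.
Proof. by apply: (@flatexp_sum_smooth _ (hump n)); exact: flatexp_sum1. Qed.

Lemma cutoff_ge0 n t : 0 <= cutoff n t.
Proof. by rewrite /cutoff -(expr0 'X) flatexpXn_ge0. Qed.

Lemma cutoff_le1 n t : cutoff n t <= 1.
Proof.
by have := flatexpXn_le 0 (hump n).[t]; rewrite expr0 => /ler_normlW.
Qed.

Lemma peak_ge0 n t : 0 <= peak n t.
Proof. by rewrite mulr_ge0 ?flatexpXn_ge0. Qed.

Lemma cutoff_eq0 n t : n.+1%:R * (t * (1 - t)) <= 1 -> cutoff n t = 0.
Proof. by move=> h; rewrite /cutoff flatexp_le0// hump_horner subr_le0. Qed.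

Lemma hump_pinfty t : I01 t -> (hump n).[t] @[n --> \oo] --> +oo.
Proof.
rewrite /= in_itv/= => /andP[t0 t1].
have a0 : 0 < t * (1 - t) by rewrite mulr_gt0// subr_gt0.
apply/cvgryPge => A; near=> n.
rewrite hump_horner lerBrDr -ler_pdivrMr//.
apply: (@le_trans _ _ n%:R); last by rewrite ler_nat.
by near: n; exact: nbhs_infty_ger.
Unshelve. all: by end_near. Qed.

Lemma cutoff_cvg t : I01 t -> cutoff n t @[n --> \oo] --> (1 : R).
Proof.
by move=> /hump_pinfty/(@cvg_flatexp_pinfty 1); rewrite !hornerE.
Qed.

(** With s = [(hump n).[t]], the weight turns n.+1 into n.+1 * t(1 - t) = s + 1, and s lowers the
    degree by [flatexpMX]. No growing factor is left, so the weighted peak is bounded uniformly in n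
    and tends to 0 pointwise. *)
Lemma weighted_peakE n t :
  t * (1 - t) * peak n t = flatexp 'X^1 (hump n).[t] + flatexp 'X^2 (hump n).[t].
Proof.
rewrite (flatexpMX 'X^1) -exprSr hump_horner /peak hump_horner; ring.
Qed.

Lemma weighted_peak_le n t : t * (1 - t) * peak n t <= 3.
Proof.
rewrite weighted_peakE (_ : 3 = 1`!%:R + 2`!%:R); last by rewrite -natrD.
by apply: lerD; exact/ler_normlW/flatexpXn_le.
Qed.

Lemma weighted_peak_cvg t : I01 t ->
  t * (1 - t) * peak n t @[n --> \oo] --> (0 : R).
Proof.
move=> /hump_pinfty h.
under eq_fun do rewrite weighted_peakE.
have := @cvgD _ _ _ _ _ _ _ _ _ (cvg_flatexp_pinfty (P := 'X^1) h)
  (cvg_flatexp_pinfty (P := 'X^2) h).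
by rewrite !hornerXn !expr0n addr0; apply.
Qed.

Lemma cutoff01 n : cutoff n 0 = 0 /\ cutoff n 1 = 0.
Proof. by split; rewrite cutoff_eq0// ?subrr ?mul0r ?mulr0. Qed.

Lemma continuous_derive_cutoffM p n : continuous
  (fun t => p^`().[t] * cutoff n t + p.[t] * ((1 - 2 * t) * peak n t)).
Proof.
move=> t; apply: cvgD; first exact: continuous_cutoffM.
apply: cvgM; first exact: continuous_horner.
apply: cvgM; last exact: continuous_peak.
apply: cvgB; first exact: cvg_cst.
by apply: cvgM; [exact: cvg_cst | exact: cvg_id].
Qed.

Lemma Rintegral_derive_cutoffM p n :
  \int[mu]_(t in I01)
    (p^`().[t] * cutoff n t + p.[t] * ((1 - 2 * t) * peak n t)) = 0.
Proof.
rewrite (Rintegral01_derive (is_derive_cutoffM p n)).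
  by have [-> ->] := cutoff01 n; rewrite !mulr0 subr0.
exact: continuous_derive_cutoffM.
Qed.

(* The weight 1 - 2t turns the sign-changing derivative (1 - 2t) * peak of the
   cutoff into a nonnegative function, and 1 = (1 - 2t)^2 + 4t(1 - t). *)
Lemma Rintegral_peak_le n : \int[mu]_(t in I01) peak n t <= 14.
Proof.
pose p : {poly R} := 1 - 2%:R *: 'X.
have pE t : p.[t] = 1 - 2 * t by rewrite /p !hornerE.
have dpE t : p^`().[t] = - 2 by rewrite /p !poly.derivE sub0r -mulr_natl !hornerE.
pose F t := p^`().[t] * cutoff n t + p.[t] * ((1 - 2 * t) * peak n t).
have cF : continuous F by exact: continuous_derive_cutoffM.
have i14 : mu.-integrable I01 (EFin \o (fun=> 14 : R)).
  by apply: continuous01_integrable => t; exact: cvg_cst.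
(* [peak] equals F + 2 * [cutoff] + 4t(1 - t) * [peak], hence is at most F + 2 + 4 * 3, and F has
   integral 0. *)
apply: (@le_trans _ _ (\int[mu]_(t in I01) (F t + 14))).
  apply: le_Rintegral => //.
  - by apply: continuous01_integrable; exact: continuous_peak.
  - by apply: continuous01_integrable => t; apply: cvgD; [exact: cF|exact: cvg_cst].
  move=> t _; rewrite /F pE dpE.
  by have := weighted_peak_le n t; have := cutoff_le1 n t; lra.
rewrite RintegralD//; last exact: continuous01_integrable.
by rewrite Rintegral_derive_cutoffM add0r Rintegral01_cst.
Qed.

Lemma Rintegral_weighted_peak_cvg :
  (\int[mu]_(t in I01) (t * (1 - t) * peak n t)) @[n --> \oo] --> (0 : R).
Proof.
have {2}<- : \int[mu]_(t in I01) (0 : R) = 0 by rewrite Rintegral01_cst.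
apply: (@Rintegral01_dominated _ _ _ (fun=> 3)).
- move=> n; apply: measurable01_continuous => t.
  apply: cvgM; last exact: continuous_peak.
  by apply: cvgM; [exact: cvg_id | apply: cvgB; [exact: cvg_cst | exact: cvg_id]].
- exact: weighted_peak_cvg.
- by apply: continuous01_integrable => t; exact: cvg_cst.
- move=> n t; rewrite /= in_itv/= => /andP[t0 t1].
  have p0 : 0 <= t * (1 - t) by rewrite mulr_ge0// ?subr_ge0 ltW.
  by rewrite ger0_norm ?weighted_peak_le// mulr_ge0 ?peak_ge0.
Qed.

(** Near the endpoints |g| is at most e by continuity; elsewhere t >= a and 1 - t >= b, so K = M /
    (a b) works for a bound M of |g|. The two summands match the two controls on [peak]: a bounded
    integral, and a vanishing one against t(1 - t). *)
Lemma within01_vanishing g (e : R) : {within `[0, 1]%classic, continuous g} ->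
  g 0 = 0 -> g 1 = 0 -> 0 < e ->
  exists2 K : R, 0 <= K & forall t, I01 t -> `|g t| <= e + K * (t * (1 - t)).
Proof.
move=> cg g0 g1 e0.
have [M M0 gM] := within01_bounded cg.
have [_ c0 c1] := (continuous_within_itvP _ (@ltr01 R)).1 cg.
rewrite g0 in c0; rewrite g1 in c1.
have /cvgr0Pnorm_le/(_ _ e0)[a /= a0 ha] := c0.
have /cvgr0Pnorm_le/(_ _ e0)[b /= b0 hb] := c1.
exists (M / (a * b)) => [|t It]; first by rewrite divr_ge0// mulr_ge0// ltW.
have tI := I01_cc It.
move: It; rewrite /= in_itv/= => /andP[t0 t1].
have p0 : 0 <= t * (1 - t) by rewrite mulr_ge0 ?subr_ge0 ?ltW.
have [ta|at_] := ltP t a.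
  rewrite (le_trans (ha t _ t0))//=; first by rewrite sub0r normrN gtr0_norm.
  by rewrite lerDl mulr_ge0// divr_ge0// mulr_ge0// ltW.
have [tb|bt] := ltP (1 - t) b.
  rewrite (le_trans (hb t _ t1))//=; first by rewrite gtr0_norm// subr_gt0.
  by rewrite lerDl mulr_ge0// divr_ge0// mulr_ge0// ltW.
have h : M <= M / (a * b) * (t * (1 - t)).
  rewrite mulrAC ler_pdivlMr ?mulr_gt0// ler_wpM2l//.
  by apply: ler_pM => //; exact: ltW.
by rewrite (le_trans (gM _ tI))// (le_trans h)// lerDr ltW.
Qed.

(** The peaks keep mass near the endpoints but lose it under the weight t(1 - t). A function that is
    small at both ends therefore sees none of it in the limit. *)
Lemma Rintegral_cutoff_boundary_cvg g : {within `[0, 1]%classic, continuous g} ->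
  g 0 = 0 -> g 1 = 0 ->
  (\int[mu]_(t in I01) (g t * ((1 - 2 * t) * peak n t))) @[n --> \oo] --> (0 : R).
Proof.
move=> cg g0 g1; apply/cvgr0Pnorm_le => e e0.
(* 28 is twice the bound 14 on the integral of [peak n], so this summand contributes at most e /
   2. *)
have [|K K0 gK] := @within01_vanishing g (e / 28) cg g0 g1; first by rewrite divr_gt0.
near=> n.
have cP : continuous (fun t => (1 - 2 * t) * peak n t).
  move=> t; apply: cvgM; last exact: continuous_peak.
  apply: cvgB; first exact: cvg_cst.
  by apply: cvgM; [exact: cvg_cst | exact: cvg_id].
have cW : continuous (fun t => t * (1 - t) * peak n t).
  move=> t; apply: cvgM; last exact: continuous_peak.
  by apply: cvgM; [exact: cvg_id | apply: cvgB; [exact: cvg_cst | exact: cvg_id]].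
have [C C0 hC] := continuous01_bounded cP.
have [M M0 gM] := within01_bounded cg.
have ig : mu.-integrable I01 (EFin \o g).
  apply: (@integrable01_bounded _ _ M); first exact: within01_measurable.
  by move=> t /I01_cc; exact: gM.
have igP := integrable01M_bounded ig (measurable01_continuous cP) hC.
have ip : mu.-integrable I01 (EFin \o peak n).
  by apply: continuous01_integrable; exact: continuous_peak.
have iw := continuous01_integrable cW.
apply: (le_trans (le_normr_Rintegral _ igP)); first exact: measurable_itv.
have cE : continuous (fun t => e / 28 * peak n t + K * (t * (1 - t) * peak n t)).
  by move=> t; apply: cvgD; (apply: cvgM; first exact: cvg_cst);
    [exact: continuous_peak | exact: cW].
apply: (@le_trans _ _
  (\int[mu]_(t in I01) (e / 28 * peak n t + K * (t * (1 - t) * peak n t)))).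
  apply: le_Rintegral => //; [|exact: continuous01_integrable|].
    by have := integrable_abse igP; congr (mu.-integrable _ _).
  move=> t It; have := gK _ It; move: It; rewrite /= in_itv/= => /andP[t0 t1].
  rewrite normrM (normrM (1 - 2 * t)) (ger0_norm (peak_ge0 n t)) => h.
  have h1 : `|1 - 2 * t| <= 1 by rewrite ler_norml; apply/andP; split; lra.
  have h2 := peak_ge0 n t.
  rewrite mulrA (mulrA K) -mulrDl ler_wpM2r//.
  by apply: le_trans h; rewrite ler_piMr.
rewrite RintegralD//; last 2 first.
- apply: (@continuous01_integrable _ (fun t => e / 28 * peak n t)) => t.
  by apply: cvgM; [exact: cvg_cst | exact: continuous_peak].
- apply: (@continuous01_integrable _ (fun t => K * (t * (1 - t) * peak n t))) => t.
  by apply: cvgM; [exact: cvg_cst | exact: cW].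
rewrite (RintegralZl (e / 28) _ ip)// (RintegralZl K _ iw)//.
have h1 := Rintegral_peak_le n.
(* K + 1 instead of K, since K may be 0. *)
have h2 : `|\int[mu]_(t in I01) (t * (1 - t) * peak n t)| <= e / (2 * (K + 1)).
  near: n; move/cvgr0Pnorm_le : Rintegral_weighted_peak_cvg; apply.
  by rewrite divr_gt0// mulr_gt0// ltr_wpDl.
have h3 : K * (e / (2 * (K + 1))) <= e / 2.
  rewrite mulrA ler_pdivrMr ?mulr_gt0 ?ltr_wpDl//; nra.
have h4 : K * \int[mu]_(t in I01) (t * (1 - t) * peak n t) <= e / 2.
  by apply: le_trans h3; rewrite ler_wpM2l// (le_trans (ler_norm _)).
have h5 : e / 28 * \int[mu]_(t in I01) peak n t <= e / 28 * 14.
  by rewrite ler_wpM2l// divr_ge0// ltW.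
by apply: (le_trans (lerD h5 h4)); lra.
Unshelve. all: by end_near. Qed.

End Cutoff.

(** * Integration by parts up to the boundary for weak derivatives *)

Section PointValue.
Context {R : realType}.
Implicit Types (x y u : R -> R) (n : nat) (t : R) (p : {poly R}).
Local Notation mu := (@lebesgue_measure R).
Local Notation I01 := (`]0, 1[%classic : set R).

Lemma test_function_cutoffM p n : test_function (fun t => p.[t] * cutoff n t).
Proof.
split=> [k t|]; first exact: cutoff_smooth.
have N0 : 0 < n.+1%:R :> R by [].
have cut t : t < n.+1%:R^-1 -> n.+1%:R * (t * (1 - t)) <= 1.
  rewrite -[X in _ < X]mul1r ltr_pdivlMr// => tN.
  have [t0|t0] := leP t 0; last by nra.
  by apply: (@le_trans _ _ 0) => //; rewrite pmulr_rle0//; nra.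
(* For n = 0 this interval is empty, consistently with [cutoff 0] being identically 0. *)
exists n.+1%:R^-1, (1 - n.+1%:R^-1); split.
- by rewrite invr_gt0.
- by rewrite ltrBlDr ltrDl invr_gt0.
move=> t; rewrite in_itv/= negb_and -!ltNge => tI.
rewrite cutoff_eq0 ?mulr0//; case/orP: tI => tI; first exact: cut.
(* The right end follows from the left one by the symmetry t -> 1 - t. *)
have := cut (1 - t); rewrite subKr (mulrC (1 - t)); apply.
by rewrite ltrBlDr addrC -ltrBlDr.
Qed.

Lemma derive1_cutoffM p n : derive1 (fun t => p.[t] * cutoff n t) =
  fun t => p^`().[t] * cutoff n t + p.[t] * ((1 - 2 * t) * peak n t).
Proof.
by apply/funext => t; rewrite derive1E; case: (is_derive_cutoffM p n t).
Qed.

Lemma measurable_mu01 y : L2 y -> measurable_fun setT y.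
Proof. by rewrite /L2 inE => /andP[+ _]; rewrite inE. Qed.

(** Passes from norms, which integrate over the whole line against [mu01], to Lebesgue integrals
    over (0,1). *)
Lemma le_integral_mu01 (f : R -> \bar R) : measurable_fun setT f ->
  (forall t, 0 <= f t)%E ->
  (\int[mu]_(t in I01) f t <= \int[mu01]_t f t)%E.
Proof.
move=> mf f0.
have -> : (\int[mu]_(t in I01) f t = \int[mu01]_(t in I01) f t)%E.
  by apply: eq_measure_integral => A mA AI; rewrite /mu01/= /mrestr setIidl.
exact: ge0_subset_integral.
Qed.

Lemma L2_integrable01 y : L2 y -> mu.-integrable I01 (EFin \o y).
Proof.
move=> L2y; have my := measurable_mu01 L2y.
have : y \in Lfun mu01 1.
  apply: Lfun_subset12 L2y; rewrite /mu01/= /mrestr setTI.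
  by rewrite [X in X \is a fin_num]mu_I01.
move=> /Lfun1_integrable/integrableP[_ yoo].
apply/integrableP; split.
  by apply/measurable_EFinP; exact: measurable_funTS.
apply: le_lt_trans yoo; apply: le_integral_mu01 => //.
by do 2 apply: measurableT_comp => //.
Qed.

Lemma ae_eq_Rintegral01M x u (h : R -> R) : u = x %[ae mu in I01] ->
  measurable_fun I01 u -> measurable_fun I01 x -> measurable_fun I01 h ->
  \int[mu]_(t in I01) (x t * h t) = \int[mu]_(t in I01) (u t * h t).
Proof.
move=> ux mu_ mx mh; rewrite /Rintegral; congr fine.
apply: ae_eq_integral => //.
- by apply/measurable_EFinP; exact: measurable_funM.
- by apply/measurable_EFinP; exact: measurable_funM.
- by apply: (@filterS _ _ (ae_filter_ringOfSetsType mu) _ _ _ ux) => t + It => ->.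
Qed.

(* Test against p * cutoff: the derivative of the cutoff only charges the two
   endpoints, where (u - u(1)) p vanishes. *)
Lemma weak_derivative_boundary x y u p : weak_derivative x y ->
  measurable_fun I01 x -> mu.-integrable I01 (EFin \o y) ->
  {within `[0, 1]%classic, continuous u} -> u = x %[ae mu in I01] -> p.[0] = 0 ->
  \int[mu]_(t in I01) ((u t - u 1) * p^`().[t]) =
  - \int[mu]_(t in I01) (y t * p.[t]).
Proof.
move=> wxy mx iy cu ux p0.
pose w t := u t - u 1.
have cw : {within `[0, 1]%classic, continuous w}.
  by move=> t; apply: cvgB; [exact: cu | exact: cvg_cst].
have mw := within01_measurable cw.
have [M M0 wM] := within01_bounded cw.
have iw : mu.-integrable I01 (EFin \o w).
  by apply: (@integrable01_bounded _ _ M) => // t /I01_cc; exact: wM.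
have [D D0 pD] := continuous01_bounded (@continuous_horner _ p^`()).
have [C C0 pC] := continuous01_bounded (@continuous_horner _ p).
have cut1 n t : `|cutoff n t| <= 1 by rewrite ger0_norm ?cutoff_ge0 ?cutoff_le1.
have mp (q : {poly R}) : measurable_fun I01 (horner q).
  by apply: measurable01_continuous; exact: continuous_horner.
have mc n : measurable_fun I01 (@cutoff R n).
  by apply: measurable01_continuous; exact: continuous_cutoff.
have lim1 : \int[mu]_(t in I01) (y t * (p.[t] * cutoff n t)) @[n --> \oo] -->
    \int[mu]_(t in I01) (y t * p.[t]).
  apply: (@Rintegral01_dominated _ _ _ (fun t => `|y t| * C)).
  - move=> n; apply: measurable_funM; last exact: measurable_funM.
    by have := measurable_int _ iy; move/measurable_EFinP.
  - move=> t It; rewrite -[X in _ --> X]mulr1.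
    under eq_fun do rewrite mulrA.
    by apply: cvgM; [exact: cvg_cst | exact: cutoff_cvg].
  - apply: (@integrable01M_bounded _ (fun t => `|y t|) (fun=> C) C).
    + by have := integrable_abse iy; congr (mu.-integrable _ _).
    + exact: measurable_cst.
    + by move=> t _; rewrite ger0_norm.
  - move=> n t It; rewrite !normrM ler_wpM2l//.
    by rewrite -[leRHS]mulr1 ler_pM// pC.
have lim2 : \int[mu]_(t in I01) (w t * (p^`().[t] * cutoff n t)) @[n --> \oo] -->
    \int[mu]_(t in I01) (w t * p^`().[t]).
  apply: (@Rintegral01_dominated _ _ _ (fun t => M * D)).
  - by move=> n; apply: measurable_funM => //; exact: measurable_funM.
  - move=> t It; rewrite -[X in _ --> X]mulr1.
    under eq_fun do rewrite mulrA.
    by apply: cvgM; [exact: cvg_cst | exact: cutoff_cvg].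
  - by apply: continuous01_integrable => t; exact: cvg_cst.
  - move=> n t It; rewrite !normrM ler_pM//; first exact/wM/I01_cc.
    by rewrite -[leRHS]mulr1 ler_pM// pD.
have lim3 : \int[mu]_(t in I01) (w t * p.[t] * ((1 - 2 * t) * peak n t))
    @[n --> \oo] --> (0 : R).
  apply: Rintegral_cutoff_boundary_cvg.
  - move=> t; apply: cvgM; first exact: cw.
    by apply: continuous_subspaceT => z; exact: continuous_horner.
  - by rewrite p0 mulr0.
  - by rewrite /w subrr mul0r.
have step n : \int[mu]_(t in I01) (y t * (p.[t] * cutoff n t)) =
   - (\int[mu]_(t in I01) (w t * (p^`().[t] * cutoff n t)) +
      \int[mu]_(t in I01) (w t * p.[t] * ((1 - 2 * t) * peak n t))).
  pose F t := p^`().[t] * cutoff n t + p.[t] * ((1 - 2 * t) * peak n t).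
  have cF : continuous F := @continuous_derive_cutoffM _ p n.
  have [B B0 FB] := continuous01_bounded cF.
  have mF := measurable01_continuous cF.
  have iF := continuous01_integrable cF.
  have cP : continuous (fun t : R => (1 - 2 * t) * peak n t).
    move=> t; apply: cvgM; last exact: continuous_peak.
    apply: cvgB; first exact: cvg_cst.
    by apply: cvgM; [exact: cvg_cst | exact: cvg_id].
  have c1 : continuous (fun t => p^`().[t] * cutoff n t).
    exact: continuous_cutoffM.
  have c2 : continuous (fun t => p.[t] * ((1 - 2 * t) * peak n t)).
    by move=> t; apply: cvgM; [exact: continuous_horner | exact: cP].
  have [B1 _ hB1] := continuous01_bounded c1.
  have [B2 _ hB2] := continuous01_bounded c2.
  have -> : \int[mu]_(t in I01) (y t * (p.[t] * cutoff n t)) =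
      - \int[mu]_(t in I01) (x t * F t).
    have -> : F = derive1 (fun t => p.[t] * cutoff n t) by rewrite derive1_cutoffM.
    by rewrite (wxy _ (test_function_cutoffM p n)) opprK.
  congr (- _).
  rewrite (ae_eq_Rintegral01M ux (within01_measurable cu) mx mF).
  (* Replacing u by w = u - u(1) is free: F is the derivative of a function vanishing at 0 and 1. *)
  rewrite (_ : \int[mu]_(t in I01) (u t * F t) =
      \int[mu]_(t in I01) (w t * F t + u 1 * F t)); last first.
    by apply: eq_Rintegral => t _; rewrite /w -mulrDl subrK.
  rewrite (RintegralD _ (integrable01M_bounded iw mF FB))
    ?(RintegralZl _ _ iF)//; last first.
    by apply: (@continuous01_integrable _ (fun t => u 1 * F t)) => t;
      apply: cvgM; [exact: cvg_cst | exact: cF].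
  rewrite Rintegral_derive_cutoffM mulr0 addr0.
  rewrite (_ : \int[mu]_(t in I01) (w t * F t) =
      \int[mu]_(t in I01) (w t * (p^`().[t] * cutoff n t) +
                           w t * (p.[t] * ((1 - 2 * t) * peak n t)))); last first.
    by apply: eq_Rintegral => t _; rewrite /F mulrDr.
  rewrite (RintegralD _ (integrable01M_bounded iw (measurable01_continuous c1) hB1)
    (integrable01M_bounded iw (measurable01_continuous c2) hB2))//.
  by congr (_ + _); apply: eq_Rintegral => t _; rewrite mulrA.
have lim4 : \int[mu]_(t in I01) (y t * (p.[t] * cutoff n t)) @[n --> \oo] -->
    - (\int[mu]_(t in I01) (w t * p^`().[t]) + 0).
  by under eq_fun do rewrite step; apply: cvgN; exact: cvgD.
by rewrite (cvg_unique (@Rhausdorff R) lim1 lim4) opprK addr0.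
Qed.

End PointValue.

(** * The moment identity, bounds on the remainder integral, and a small moment in each block *)

Section MomentBounds.
Context {R : realType}.
Implicit Types (x y : R -> R) (v t d E : R) (a : nat -> R).
Local Notation mu := (@lebesgue_measure R).
Local Notation I01 := (`]0, 1[%classic : set R).

Lemma exprn01_le1 (k : nat) t : I01 t -> `|t ^+ k| <= 1.
Proof.
rewrite /= in_itv/= => /andP[t0 t1].
by rewrite ger0_norm ?exprn_ge0 ?exprn_ile1// ltW.
Qed.

(** Take p = X^(j+1), which vanishes at 0. Its derivative (j+1) t^j has integral 1, so the
    subtracted constant u(1) reappears with coefficient 1. *)
Lemma moments_value1 x y v (j : nat) : H1 x y -> value1 x v ->
  j.+1%:R * moments x j = v - \int[mu]_(t in I01) (y t * t ^+ j.+1).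
Proof.
move=> [L2x L2y wxy] [u [cu ux u1]].
have mx := measurable_funTS (measurable_mu01 L2x) : measurable_fun I01 x.
have iy := L2_integrable01 L2y.
have mj := measurable01_continuous (@exprn_continuous R j).
have p0 : ('X^(j.+1) : {poly R}).[0] = 0 by rewrite hornerXn expr0n.
have := weak_derivative_boundary wxy mx iy cu ux p0.
have -> : \int[mu]_(t in I01) (y t * ('X^(j.+1)).[t]) =
    \int[mu]_(t in I01) (y t * t ^+ j.+1).
  by apply: eq_Rintegral => t _; rewrite hornerXn.
move=> <-; rewrite /moments.
have -> : \int[mu]_(t in I01) (t ^+ j * x t) = \int[mu]_(t in I01) (u t * t ^+ j).
  rewrite -(ae_eq_Rintegral01M ux (within01_measurable cu) mx mj).
  by apply: eq_Rintegral => t _; rewrite mulrC.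
have [M M0 uM] := within01_bounded cu.
have iu : mu.-integrable I01 (EFin \o u).
  apply: (@integrable01_bounded _ _ M); first exact: within01_measurable.
  by move=> t /I01_cc; exact: uM.
have iut := integrable01M_bounded iu mj (@exprn01_le1 j).
have it := continuous01_integrable (@exprn_continuous R j).
have -> : \int[mu]_(t in I01) ((u t - u 1) * ('X^(j.+1))^`().[t]) =
    \int[mu]_(t in I01) (j.+1%:R * (u t * t ^+ j) - j.+1%:R * u 1 * t ^+ j).
  by apply: eq_Rintegral => t _; rewrite derivXn hornerMn hornerXn -mulr_natl; ring.
rewrite RintegralB//; last 2 first.
- exact: (integrableZl _ _ iut).
- exact: (integrableZl _ _ it).
rewrite (RintegralZl _ _ iut)// (RintegralZl _ _ it)// Rintegral01_exprn u1.
by field; rewrite addrC natr1 pnatr_eq0.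
Qed.

Lemma integral01_exprn (k : nat) :
  (\int[mu]_(t in I01) (t ^+ k)%:E)%E = (k.+1%:R^-1)%:E.
Proof.
rewrite -Rintegral01_exprn /Rintegral fineK//.
by apply: integrable_fin_num => //;
  exact: (continuous01_integrable (@exprn_continuous R k)).
Qed.

Lemma Rintegral_exprn_L2_le y E (k : nat) : L2 y -> (normL 2%:E y <= E%:E)%E ->
  `|\int[mu]_(t in I01) (y t * t ^+ k)| <= E * Num.sqrt ((2 * k).+1%:R^-1).
Proof.
move=> L2y yE; have my := measurable_mu01 L2y.
have iy := L2_integrable01 L2y.
have iyk := integrable01M_bounded iy (measurable01_continuous (@exprn_continuous R k))
  (@exprn01_le1 k).
(* Extending by 0 lets the norm of g, an integral over the whole line, reduce to the integral of
   t^(2k) over (0,1). *)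
pose g : R -> R := (fun t => t ^+ k) \_ I01.
have mg : measurable_fun setT g.
  exact/(measurable_restrictT _ _).1.
have Ng : ('N[mu01]_2%:E[EFin \o g] = (Num.sqrt ((2 * k).+1%:R^-1))%:E :> \bar R)%E.
  rewrite unlock -powR12_sqrt ?invr_ge0// -poweR_EFin -integral01_exprn.
  congr (_ `^ _)%E.
  have -> : (\int[mu]_(t in I01) (t ^+ (2 * k))%:E =
             \int[mu01]_(t in I01) (t ^+ (2 * k))%:E)%E.
    by apply: eq_measure_integral => A mA AI; rewrite /mu01/= /mrestr setIidl.
  rewrite [RHS]integral_mkcond; apply: eq_integral => t _.
  rewrite /g /= !patchE; case: ifPn => tI; rewrite /= ?normr0 ?powR0//.
  by rewrite (@powR_mulrn _ _ 2)// real_normK ?num_real// -exprM mulnC.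
rewrite -lee_fin EFin_normr_Rintegral//.
have -> : (E * Num.sqrt ((2 * k).+1%:R^-1))%:E =
    (E%:E * 'N[mu01]_2%:E[EFin \o g])%E by rewrite Ng.
apply: (@le_trans _ _ 'N[mu01]_1[EFin \o (y \* g)%R]%E); last first.
  apply: le_trans.
    by apply: (@hoelder _ _ _ mu01 y g 2 2) => //; rewrite [RHS]splitr !div1r.
  by rewrite lee_wpmul2r// Lnorm_ge0.
rewrite Lnorm1.
apply: (le_trans (le_abse_integral _ _ _)); first exact: measurable_itv.
  exact: measurable_int iyk.
have -> : (\int[mu]_(t in I01) `|(y t * t ^+ k)%:E| =
    \int[mu]_(t in I01) `|(EFin \o (y \* g)%R) t|)%E.
  by apply: eq_integral => t tI; rewrite /= /g patchE tI.
apply: le_integral_mu01.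
  by do 2 apply: measurableT_comp => //; exact: measurable_funM.
by move=> t; exact: abse_ge0.
Qed.

Lemma Rintegral_exprn_Loo_le y E (k : nat) : L2 y -> (normL +oo y <= E%:E)%E ->
  `|\int[mu]_(t in I01) (y t * t ^+ k)| <= E * k.+1%:R^-1.
Proof.
move=> L2y yE; have my := measurable_mu01 L2y.
have iy := L2_integrable01 L2y.
have iyk := integrable01M_bounded iy (measurable01_continuous (@exprn_continuous R k))
  (@exprn01_le1 k).
have yE' : {ae mu, forall t, I01 t -> `|y t| <= E}.
  (* At exponent +oo the norm is the essential supremum only if the total mass is positive, so this
     mass is computed first. *)
  move: yE; rewrite /normL unlock /= [X in (0 < X)%E](_ : _ = 1%E); last first.
    by rewrite /mu01/= /mrestr setTI [LHS]mu_I01.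
  rewrite lte01 => /ess_supP[A [mA A0 PA]].
  exists (A `&` I01); split => //; first exact: measurableI.
  move=> t /= /not_implyP[It yt]; split => //; apply: PA => /=.
  by rewrite lee_fin.
have E0 : 0 <= E by rewrite -lee_fin (le_trans _ yE)// Lnorm_ge0.
rewrite -lee_fin EFin_normr_Rintegral//.
apply: (le_trans (le_abse_integral _ _ _)); first exact: measurable_itv.
  exact: measurable_int iyk.
rewrite EFinM -integral01_exprn -ge0_integralZl//; last 2 first.
- by apply/measurable_EFinP; exact: measurable01_continuous (@exprn_continuous R k).
- by move=> t; rewrite /= in_itv/= => /andP[t0 _]; rewrite lee_fin exprn_ge0// ltW.
apply: ae_ge0_le_integral => //.
- by apply: measurableT_comp => //; exact: measurable_int iyk.
- move=> t; rewrite /= in_itv/= => /andP[t0 _].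
  by rewrite -EFinM lee_fin mulr_ge0// exprn_ge0// ltW.
- apply/measurable_EFinP; apply: (@measurable01_continuous _ (fun t => E * t ^+ k)).
  by move=> t; apply: cvgM; [exact: cvg_cst | exact: exprn_continuous].
- apply: (@filterS _ _ (ae_filter_ringOfSetsType mu) _ _ _ yE') => t h It.
  rewrite -EFinM lee_fin normrM ler_pM// ?h//.
  by move: It; rewrite /= in_itv/= => /andP[t0 _]; rewrite ger0_norm// exprn_ge0// ltW.
Qed.

(* The smallest entry of a block is at most its quadratic mean. *)
Lemma norm_l2_block a d (n : nat) : (norm_l2 a <= d%:E)%E -> (0 < n)%N ->
  exists2 j : nat, (n <= j < n + n)%N & `|a j| <= d / Num.sqrt n%:R.
Proof.
move=> ad n0.
have d0 : 0 <= d by rewrite -lee_fin (le_trans _ ad)// Lnorm_ge0.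
have sn : 0 < Num.sqrt (n%:R : R) by rewrite sqrtr_gt0 ltr0n.
apply: contrapT => h.
have lt_a j : (n <= j < n + n)%N -> d ^+ 2 / n%:R < `|a j| ^+ 2.
  move=> jn; rewrite -[n%:R]sqr_sqrtr// -expr_div_n ltr_pXn2r ?nnegrE ?divr_ge0 ?sqrtr_ge0//.
  by rewrite ltNge; apply/negP => aj; apply: h; exists j.
have : \sum_(n <= j < n + n) d ^+ 2 / n%:R < \sum_(n <= j < n + n) `|a j| ^+ 2.
  by apply: ltr_sum_nat => //; rewrite -[X in (X < _)%N]addn0 ltn_add2l.
rewrite sumr_const_nat addnK -(mulr_natr (d ^+ 2 / n%:R)) divfK ?pnatr_eq0 -?lt0n//.
apply/negP; rewrite -leNgt -lee_fin.
have S : (\sum_(0 <= k <oo) `|(a k)%:E| `^ 2 <= (d ^+ 2)%:E)%E.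
  rewrite -(@ge0_integral_count _ (fun k => (`|(a k)%:E| `^ 2)%E)).
    rewrite -(@poweR_Lnorm _ _ _ counting (EFin \o a) 2)//.
    apply: (@le_trans _ _ (d%:E `^ 2)%E).
      by apply: gt0_ler_poweR => //; rewrite in_itv/= ?leey ?Lnorm_ge0 ?lee_fin ?d0.
    by rewrite poweR_EFin (@powR_mulrn _ _ 2).
  by move=> k; exact: poweR_ge0.
apply: le_trans S.
(* Truncate the nonnegative series at 2n, then drop the entries below n. *)
apply: le_trans (nneseries_lim_ge (n + n) _); last by move=> k _ _; exact: poweR_ge0.
rewrite -sumEFin [leRHS](@big_cat_nat _ _ _ n)// ?leq_addr//.
rewrite -[leLHS]add0e leeD//.
  by apply: sume_ge0 => i _; exact: poweR_ge0.
by apply: lee_sum => i _; rewrite poweR_EFin (@powR_mulrn _ _ 2).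
Qed.

End MomentBounds.

(** * Choice of the block length, stability estimates and suprema *)

Section Stability.
Context {R : realType}.
Implicit Types (x y : R -> R) (v t a d E : R) (n : nat).
Local Notation mu := (@lebesgue_measure R).
Local Notation I01 := (`]0, 1[%classic : set R).

(** For j in [n, 2n) the factor j.+1 is at most 2n, while the exponent j.+1 exceeds n; hence B has
    to bound the remainder for k > n only. *)
Lemma value1_le x y v d B n : H1 x y -> value1 x v ->
  (norm_l2 (moments x) <= d%:E)%E -> (0 < n)%N ->
  (forall k, (n < k)%N -> `|\int[mu]_(t in I01) (y t * t ^+ k)| <= B) ->
  `|v| <= 2 * Num.sqrt n%:R * d + B.
Proof.
move=> hxy hv hd n0 hB.
have [j /andP[nj j2n] aj] := norm_l2_block hd n0.
have e := moments_value1 j hxy hv.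
have -> : v = j.+1%:R * moments x j + \int[mu]_(t in I01) (y t * t ^+ j.+1).
  by rewrite e subrK.
apply: (le_trans (ler_normD _ _)); apply: lerD; last exact: hB.
rewrite normrM ger0_norm//.
have sn : 0 < Num.sqrt (n%:R : R) by rewrite sqrtr_gt0 ltr0n.
have -> : 2 * Num.sqrt n%:R * d = (n + n)%:R * (d / Num.sqrt (n%:R : R)).
  rewrite natrD; have := @sqr_sqrtr R n%:R; move: sn.
  by set s := Num.sqrt _ => sn <-//; field; rewrite gt_eqF.
by apply: ler_pM => //; rewrite ler_nat.
Qed.

Lemma normL_ge0 (p : \bar R) y E : (normL p y <= E%:E)%E -> 0 <= E.
Proof. by move=> h; rewrite -lee_fin (le_trans _ h)// Lnorm_ge0. Qed.

Lemma value1_L2_le x y v d E n : H1 x y -> value1 x v ->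
  (normL 2%:E y <= E%:E)%E ->
  (norm_l2 (moments x) <= d%:E)%E -> (0 < n)%N ->
  `|v| <= 2 * Num.sqrt n%:R * d + E / Num.sqrt n%:R.
Proof.
move=> hxy hv yE hd n0; apply: (value1_le hxy hv hd n0) => k nk.
have [_ L2y _] := hxy.
apply: (le_trans (Rintegral_exprn_L2_le _ L2y yE)).
rewrite ler_wpM2l ?(normL_ge0 yE)// -sqrtrV// ler_wsqrtr// lef_pV2 ?posrE ?ltr0n//.
by rewrite ler_nat; lia.
Qed.

Lemma value1_Loo_le x y v d E n : H1 x y -> value1 x v ->
  (normL +oo y <= E%:E)%E ->
  (norm_l2 (moments x) <= d%:E)%E -> (0 < n)%N ->
  `|v| <= 2 * Num.sqrt n%:R * d + E / n%:R.
Proof.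
move=> hxy hv yE hd n0; apply: (value1_le hxy hv hd n0) => k nk.
have [_ L2y _] := hxy.
apply: (le_trans (Rintegral_exprn_Loo_le _ L2y yE)).
rewrite ler_wpM2l ?(normL_ge0 yE)// lef_pV2 ?posrE ?ltr0n//.
by rewrite ler_nat; lia.
Qed.

(** Rounding a^-2 up to an integer costs at most 1 in the square root, because a^-2 + 1 <= (a^-1 +
    1)^2. *)
Lemma sqrt_nat_between a : 0 < a ->
  exists2 n : nat, (0 < n)%N & a^-1 <= Num.sqrt n%:R <= a^-1 + 1.
Proof.
move=> a0; have aV0 : 0 < a^-1 by rewrite invr_gt0.
have /andP[le_n lt_n] := truncn_itv (ltW (exprn_gt0 2 aV0)).
exists (Num.truncn (a^-1 ^+ 2)).+1 => //; apply/andP; split.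
  by rewrite -[leLHS](ger0_norm (ltW aV0)) -sqrtr_sqr ler_wsqrtr// ltW.
rewrite -[leRHS]ger0_norm ?addr_ge0 ?(ltW aV0)// -sqrtr_sqr ler_wsqrtr//.
rewrite -natr1; nra.
Qed.

(** Here n is of order 1/d rather than E/d, which also covers E = 0. The constant becomes linear in
    E, harmless for asymptotics at fixed E, and d <= 1 absorbs the rounding. *)
Lemma value1_L2_sqrt x y v d E : H1 x y -> value1 x v ->
  (normL 2%:E y <= E%:E)%E -> (norm_l2 (moments x) <= d%:E)%E -> 0 < d <= 1 ->
  `|v| <= (4 + E) * Num.sqrt d.
Proof.
move=> hxy hv yE hd /andP[d0 d1].
have E0 := normL_ge0 yE.
have s0 : 0 < Num.sqrt d by rewrite sqrtr_gt0.
have s1 : Num.sqrt d <= 1 by rewrite -sqrtr1 ler_wsqrtr.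
have [n n0 /andP[n1 n2]] := sqrt_nat_between s0.
apply: (le_trans (value1_L2_le hxy hv yE hd n0)); rewrite (mulrDl 4 E); apply: lerD.
  apply: (@le_trans _ _ (2 * ((Num.sqrt d)^-1 + 1) * d)).
    by rewrite ler_pM2r// ler_wpM2l.
  have := @sqr_sqrtr R d (ltW d0); move: s0 s1; set s := Num.sqrt d => s0 s1 <-.
  rewrite (_ : 2 * (s^-1 + 1) * s ^+ 2 = 2 * s * (1 + s)); last first.
    by field; rewrite gt_eqF.
  by nra.
rewrite ler_wpM2l// -[leRHS]invrK lef_pV2 ?posrE ?invr_gt0//.
by rewrite (lt_le_trans _ n1)// invr_gt0.
Qed.

(** With s = d^(1/3) and sqrt n about 1/s, both sqrt n * d and 1/n are of order s^2. *)
Lemma value1_Loo_powR x y v d E : H1 x y -> value1 x v ->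
  (normL +oo y <= E%:E)%E -> (norm_l2 (moments x) <= d%:E)%E -> 0 < d <= 1 ->
  `|v| <= (4 + E) * d `^ (2 / 3).
Proof.
move=> hxy hv yE hd /andP[d0 d1].
have E0 := normL_ge0 yE.
pose s := d `^ 3^-1.
have s0 : 0 < s by rewrite powR_gt0.
have s3 : d = s ^+ 3.
  by rewrite -powR_mulrn ?ltW// -powRrM mulVf// powRr1// ltW.
have -> : d `^ (2 / 3) = s ^+ 2.
  by rewrite -powR_mulrn ?ltW// -powRrM mulrC.
have s1 : s <= 1 by move: d1; rewrite s3 expr_le1// ltW.
have [n n0 /andP[n1 n2]] := sqrt_nat_between s0.
apply: (le_trans (value1_Loo_le hxy hv yE hd n0)); rewrite (mulrDl 4 E); apply: lerD.
  apply: (@le_trans _ _ (2 * (s^-1 + 1) * d)).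
    by rewrite ler_pM2r// ler_wpM2l.
  rewrite s3 (_ : 2 * (s^-1 + 1) * s ^+ 3 = 2 * s ^+ 2 * (1 + s)); last first.
    by field; rewrite gt_eqF.
  have := sqr_ge0 s; nra.
rewrite ler_wpM2l// -[leRHS]invrK lef_pV2 ?posrE ?invr_gt0 ?exprn_gt0 ?ltr0n//.
rewrite -exprVn -[leRHS](@sqr_sqrtr R)// ler_pXn2r ?nnegrE ?invr_ge0 ?sqrtr_ge0//.
exact: ltW.
Qed.

(** The two terms balance for n about E/d. Rounding n adds 2d, which is at most 2 sqrt K * sqrt(E d)
    thanks to d <= K E; this is the dependence of the constant on K. *)
Lemma value1_L2_sqrtM x y v d E (K : R) : H1 x y -> value1 x v ->
  (normL 2%:E y <= E%:E)%E -> (norm_l2 (moments x) <= d%:E)%E ->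
  0 < K -> d <= K * E ->
  `|v| <= (2 * (1 + Num.sqrt K) + 1) * Num.sqrt (E * d).
Proof.
move=> hxy hv yE hd K0 dK.
have E0 := normL_ge0 yE.
have d0 : 0 <= d by rewrite -lee_fin (le_trans _ hd)// Lnorm_ge0.
have bound n (n0 : (0 < n)%N) := value1_L2_le hxy hv yE hd n0.
have [dz|dN0] := eqVneq d 0.
  rewrite dz mulr0 sqrtr0 mulr0 leNgt; apply/negP => v0.
  (* For d = 0 only E / sqrt n remains, and this n makes |v| sqrt n >= E + 1, a contradiction. *)
  have [n n0 /andP[n1 _]] := sqrt_nat_between (divr_gt0 v0 (ltr_wpDl E0 ltr01)).
  have := bound n n0; rewrite dz mulr0 add0r; apply/negP; rewrite -ltNge.
  have sn : 0 < Num.sqrt (n%:R : R) by rewrite sqrtr_gt0 ltr0n.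
  move: n1; rewrite invf_div ler_pdivrMr// ltr_pdivrMr// => n1.
  by rewrite mulrC (lt_le_trans _ n1)// ltrDl.
have dp : 0 < d by rewrite lt_neqAle eq_sym dN0.
have Ep : 0 < E by rewrite -(pmulr_rgt0 _ K0) (lt_le_trans dp).
rewrite sqrtrM//.
have := @sqr_sqrtr R d d0; have := @sqr_sqrtr R E E0; have := @sqr_sqrtr R K (ltW K0).
have : 0 < Num.sqrt d by rewrite sqrtr_gt0.
have : 0 < Num.sqrt E by rewrite sqrtr_gt0.
have : 0 < Num.sqrt K by rewrite sqrtr_gt0.
set k := Num.sqrt K; set T := Num.sqrt E; set S := Num.sqrt d => k0 T0 S0 kE TE SE.
have ST : S <= k * T.
  by rewrite -(@ler_pXn2r _ 2) ?nnegrE ?mulr_ge0 ?(ltW S0) ?(ltW k0) ?(ltW T0)//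
    exprMn SE kE TE.
have [n n0 /andP[n1 n2]] := sqrt_nat_between (divr_gt0 S0 T0).
rewrite invf_div in n1 n2.
apply: (le_trans (bound n n0)); rewrite (mulrDl (2 * (1 + k)) 1) mul1r; apply: lerD.
  apply: (@le_trans _ _ (2 * (T / S + 1) * d)).
    by rewrite ler_pM2r// ler_wpM2l.
  rewrite -SE (_ : 2 * (T / S + 1) * S ^+ 2 = 2 * S * (T + S)); last first.
    by field; rewrite gt_eqF.
  rewrite (_ : 2 * (1 + k) * (T * S) = 2 * S * (T + k * T)); last by ring.
  by rewrite ler_wpM2l ?lerD2l// mulr_ge0// ltW.
have sn : 0 < Num.sqrt (n%:R : R) by rewrite sqrtr_gt0 ltr0n.
rewrite ler_pdivrMr// -TE; rewrite ler_pdivrMr// in n1.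
by rewrite expr2 -mulrA ler_wpM2l ?(ltW T0)// mulrC.
Qed.

(** Below exp(-1) the factor ln(1/d) is at least 1, so it only enlarges the previous bound. *)
Lemma value1_Loo_powR_ln x y v d E : H1 x y -> value1 x v ->
  (normL +oo y <= E%:E)%E -> (norm_l2 (moments x) <= d%:E)%E ->
  0 < d < expR (- 1) ->
  `|v| <= (4 + E) * (d `^ (2 / 3) * ln (1 / d)).
Proof.
move=> hxy hv yE hd /andP[d0 de].
have d1 : d <= 1 by rewrite (le_trans (ltW de))// -expR0 ler_expR lerN10.
apply: (@le_trans _ _ ((4 + E) * d `^ (2 / 3))).
  by apply: (value1_Loo_powR hxy hv yE hd); rewrite d0.
rewrite ler_wpM2l ?addr_ge0 ?(normL_ge0 yE)// ler_peMr ?powR_ge0//.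
rewrite -[leLHS](@expRK R) ler_ln ?posrE ?expR_gt0 ?divr_gt0//.
by rewrite div1r -[leLHS]invrK -expRN lef_pV2 ?posrE ?expR_gt0// ltW.
Qed.

(** The zero function is admissible, which rules out the value -oo of an empty supremum; [ebigO_0]
    demands finiteness. *)
Lemma sup_value1_ge0 (p : \bar R) E d : p != 0%E -> 0 <= E -> 0 <= d ->
  (0 <= sup_value1 p E d)%E.
Proof.
move=> p0 E0 d0; apply: ereal_sup_ubound.
have L20 : @L2 R (cst 0).
  rewrite /L2 inE; apply/andP; split; rewrite inE/=; first exact: measurable_cst.
  by apply: finite_norm_cst0; rewrite lee_fin ler1n.
exists (cst 0), (cst 0), 0; split.
- split => // phi _.
  rewrite [LHS](_ : _ = 0) ?[X in - X](_ : _ = 0) ?oppr0//.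
  + by under eq_Rintegral do rewrite mul0r; rewrite Rintegral01_cst.
  + by under eq_Rintegral do rewrite mul0r; rewrite Rintegral01_cst.
- rewrite /normL (_ : EFin \o cst 0 = cst 0)//.
  by rewrite Lnorm0.
- rewrite /norm_l2 (_ : EFin \o moments _ = cst 0%E) ?Lnorm0//.
  apply/funext => j; rewrite /= /moments.
  by under eq_Rintegral do rewrite mulr0; rewrite Rintegral01_cst.
- exists (cst 0); split => //; last exact: ae_eq_refl.
  by apply: continuous_subspaceT => t; exact: cvg_cst.
- by rewrite normr0.
Qed.

Lemma ebigO_sup_value1 (p : \bar R) E C d0 (g : R -> R) :
  p != 0%E -> 0 <= E -> 0 < C -> 0 < d0 ->
  (forall x y v d, H1 x y -> (normL p y <= E%:E)%E -> value1 x v ->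
    (norm_l2 (moments x) <= d%:E)%E -> 0 < d < d0 -> `|v| <= C * g d) ->
  ebigO_0 (sup_value1 p E) g.
Proof.
move=> p0 E0 C0 d00 h.
have hsup d : 0 < d < d0 -> (0 <= sup_value1 p E d <= (C * g d)%:E)%E.
  move=> dd; rewrite sup_value1_ge0//=; last by case/andP: dd => /ltW.
  apply/ereal_supP => r [x [y [v [hxy yE xd hv ->]]]].
  by rewrite lee_fin; exact: (h x y v d hxy yE hv xd dd).
have near0 : \forall d \near (0 : R)^'+, 0 < d < d0.
  near=> d; apply/andP; split; near: d; first exact: nbhs_right_gt.
  exact: nbhs_right_lt.
split.
  near=> d; have /andP[h1 h2] : (0 <= sup_value1 p E d <= (C * g d)%:E)%E.
    by apply: hsup; near: d; exact: near0.
  by rewrite ge0_fin_numE// (le_lt_trans h2)// ltry.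
apply/eqO_exP; exists C => //.
near=> d; have /andP[h1 h2] : (0 <= sup_value1 p E d <= (C * g d)%:E)%E.
  by apply: hsup; near: d; exact: near0.
rewrite /= ger0_norm ?fine_ge0//.
apply: (@le_trans _ _ (C * g d)); last by rewrite ler_pM2l// ler_norm.
rewrite -lee_fin fineK// ge0_fin_numE// (le_lt_trans h2)// ltry//.
Unshelve. all: by end_near. Qed.

End Stability.

Theorem theorem2 (R : realType) :
  (* (i): on d <= K * E1 the constant depends on K only; constant functions
     show that some restriction to small d is unavoidable *)
  [/\ forall K : R, 0 < K ->
        exists C : R, 0 < C /\
        forall (E1 : R) (x x' : R -> R) (v d : R),
          0 <= E1 ->
          H1 x x' -> (normL 2%:E x' <= E1%:E)%E -> value1 x v ->
          norm_l2 (moments x) = d%:E -> d <= K * E1 ->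
          `|v| <= C * Num.sqrt (E1 * d),
      forall E1 : R, 0 <= E1 ->
        ebigO_0 (sup_value1 2%:E E1) (fun d => Num.sqrt d),
  (* (ii) *)
      forall Einf : R, 0 <= Einf ->
        exists C d0 : R, [/\ 0 < C, 0 < d0 &
        forall (x x' : R -> R) (v d : R),
          H1 x x' -> (normL +oo x' <= Einf%:E)%E -> value1 x v ->
          norm_l2 (moments x) = d%:E -> 0 < d < d0 ->
          `|v| <= C * (d `^ (2 / 3) * ln (1 / d))],
      forall Einf : R, 0 <= Einf ->
        ebigO_0 (sup_value1 +oo Einf) (fun d => d `^ (2 / 3) * ln (1 / d))
  (* (iii) *)
    & forall Einf c : R, 0 <= Einf -> 0 < c ->
        exists C : R, 0 < C /\
        forall (x x' : R -> R) (v d : R),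
          H1 x x' -> (normL +oo x' <= Einf%:E)%E -> value1 x v ->
          norm_l2 (moments x) = d%:E -> c <= d ->
          `|v| <= C * d].
Proof.
split.
- move=> K K0; exists (2 * (1 + Num.sqrt K) + 1); split.
    by rewrite ltr_wpDl// mulr_ge0// addr_ge0 ?sqrtr_ge0.
  by move=> E1 x y v d E0 hxy yE hv hd dK;
    apply: (value1_L2_sqrtM hxy hv yE _ K0 dK); rewrite hd.
- move=> E E0; apply: (@ebigO_sup_value1 _ _ _ (4 + E) 1) => //.
    by rewrite ltr_wpDr.
  move=> x y v d hxy yE hv hd /andP[d0 d1].
  by apply: (value1_L2_sqrt hxy hv yE hd); rewrite d0 ltW.
- move=> E E0; exists (4 + E), (expR (- 1)); split; [by rewrite ltr_wpDr|exact: expR_gt0|].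
  move=> x y v d hxy yE hv hd dd.
  by apply: (value1_Loo_powR_ln hxy hv yE _ dd); rewrite hd.
- move=> E E0; apply: (@ebigO_sup_value1 _ _ _ (4 + E) (expR (- 1))) => //.
  + by rewrite ltr_wpDr.
  + by move=> x y v d hxy yE hv hd dd; exact: (value1_Loo_powR_ln hxy hv yE hd dd).
(* The block n = 1 gives |v| <= 2d + E, and E <= (E / c) d once d >= c. *)
- move=> E c E0 c0; exists (2 + E / c); split.
    by rewrite ltr_wpDr// divr_ge0// ltW.
  move=> x y v d hxy yE hv hd cd.
  have hd' : (norm_l2 (moments x) <= d%:E)%E by rewrite hd.
  apply: (le_trans (value1_Loo_le hxy hv yE hd' (ltn0Sn 0))).
  rewrite sqrtr1 mulr1 divr1 (mulrDl 2 (E / c)) lerD2l mulrAC ler_pdivlMr//.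
  by rewrite ler_wpM2l.
Qed.
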